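(* Let $n\ge0$, $k\ge1$ and $m\ge3$ be integers. The area of the $m$-sided polygon with vertices, in order, $V_i=(P_{n+2ik},P_{n+(2i+1)k})$ for $i=0,1,\dots,m-1$ equals $$\frac12\left|(m-1)P_kP_{2k}-P_kP_{(2m-2)k}\right|.$$ The area of the $m$-sided polygon with vertices, in order, $W_i=(Q_{n+2ik},Q_{n+(2i+1)k})$ for $i=0,1,\dots,m-1$ equals $$4\left|(m-1)P_kP_{2k}-P_kP_{(2m-2)k}\right|.$$
   Context: $P_n$ denotes the Pell numbers ($P_0=0$, $P_1=1$, $P_{n+1}=2P_n+P_{n-1}$) and $Q_n$ the Pell–Lucas numbers ($Q_0=2$, $Q_1=2$, $Q_{n+1}=2Q_n+Q_{n-1}$). The area of a polygon with vertices $(x_1,y_1),\dots,(x_m,y_m)$ taken in this order is given by the shoelace formula $\frac12\left|\sum_{i=1}^{m}(x_iy_{i+1}-x_{i+1}y_i)\right|$, indices taken mod $m$. *)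

(* Defs.v *)
From HB Require Import structures.
From mathcomp Require Import all_boot all_order all_algebra.

Set Implicit Arguments.
Unset Strict Implicit.
Unset Printing Implicit Defensive.

Import Order.TTheory GRing.Theory Num.Theory.

Fixpoint pell (n : nat) : nat :=
  if n is n1.+1 then
    if n1 is n2.+1 then 2 * pell n1 + pell n2 else 1
  else 0.

(* Normalised with initial values 2, 2 (some authors halve these numbers). *)
Fixpoint pell_lucas (n : nat) : nat :=
  if n is n1.+1 then
    if n1 is n2.+1 then 2 * pell_lucas n1 + pell_lucas n2 else 2
  else 2.

Local Open Scope ring_scope.

(* [ordS] is the cyclic successor on ['I_m], so the indices wrap around
   modulo [m]. *)
Definition polygon_area (R : realFieldType) (m : nat) (V : 'I_m -> R * R) : R :=
  2^-1 * `| \sum_(i < m) ((V i).1 * (V (ordS i)).2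
                          - (V (ordS i)).1 * (V i).2) |.

(* Main.v *)
(* Every solution [u] of the Pell recurrence satisfies Vajda's identity
     u(a+i) u(a+j) - u(a) u(a+i+j) = (-1)^a (u(1)^2 - u(0) u(2)) P(i) P(j).
   In the shoelace sum, each of the first [m - 1] terms is minus this expression
   with [(i, j) = (2k, k)], where [a = n + 2ik] has the parity of [n]; the
   wrap-around term is this expression with [(a, i, j) = (n, (2m-2)k, k)].
   The factor [u(1)^2 - u(0) u(2)] is [1] for [P] and [-8] for [Q]. *)
Require Import Defs.
From mathcomp Require Import all_boot all_order all_algebra.
From mathcomp Require Import zify ring.

Import Order.TTheory GRing.Theory Num.Theory.
Local Open Scope ring_scope.

Definition pell_recurrence {R : comPzRingType} (u : nat -> R) :=
  forall n, u n.+2 = 2 * u n.+1 + u n.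

(** Reduces an identity whose two sides both solve the recurrence in one index to its cases 0 and
    1. *)
Lemma pell_recurrence_eq (R : comPzRingType) (u v : nat -> R) :
  pell_recurrence u -> pell_recurrence v -> u 0%N = v 0%N -> u 1%N = v 1%N ->
  u =1 v.
Proof.
move=> uS vS e0 e1 n.
suff [] : u n = v n /\ u n.+1 = v n.+1 by [].
by elim: n => [|n [en en1]]; split=> //; rewrite uS vS en en1.
Qed.

Lemma pell_is_pell_recurrence (R : comPzRingType) :
  pell_recurrence (fun n => (pell n)%:R : R).
Proof. by move=> n; rewrite -natrM -natrD. Qed.

Lemma pell_lucas_is_pell_recurrence (R : comPzRingType) :
  pell_recurrence (fun n => (pell_lucas n)%:R : R).
Proof. by move=> n; rewrite -natrM -natrD. Qed.

Section PellRecurrence.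

Variables (R : comNzRingType) (u : nat -> R).
Hypothesis uS : pell_recurrence u.

Let c : R := u 1 ^+ 2 - u 0 * u 2.

(** By the recurrence, raising [a] by one only flips the sign of the left side. *)
Lemma pell_cassini a : u a.+1 ^+ 2 - u a * u a.+2 = (-1) ^+ a * c.
Proof.
elim: a => [|a IHa]; first by rewrite mul1r.
by rewrite (exprS (-1)) -mulrA -IHa !uS; ring.
Qed.

(** For fixed [a] both sides solve the recurrence in [j]; they vanish at [j = 0], and [j = 1] is
    [pell_cassini]. *)
Lemma pell_docagne a j :
  u a.+1 * u (a + j) - u a * u (a + j).+1 = (-1) ^+ a * c * (pell j)%:R.
Proof.
move: j; apply: pell_recurrence_eq => [j|j||].
- by rewrite !addnS !uS; ring.
- by rewrite pell_is_pell_recurrence; ring.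
- by rewrite addn0 /=; ring.
- by rewrite addn1 /= -pell_cassini; ring.
Qed.

(** The same argument in [i], with [a] and [j] fixed: both sides vanish at [i = 0], and [i = 1] is
    [pell_docagne]. *)
Lemma pell_vajda a i j :
  u (a + i) * u (a + j) - u a * u (a + i + j) =
  (-1) ^+ a * c * (pell i)%:R * (pell j)%:R.
Proof.
move: i; apply: pell_recurrence_eq => [i|i||].
- by rewrite !addnS !addSn !uS; ring.
- by rewrite pell_is_pell_recurrence; ring.
- by rewrite addn0 /=; ring.
- by rewrite addn1 addSn pell_docagne /=; ring.
Qed.

(** Counting the sides as [m.+1] turns the factors m - 1 and 2m - 2 into [m] and [2 * m], free of
    truncated subtraction. *)
Lemma pell_shoelace n k m :
  let x i := u (n + 2 * i * k) in
  let y i := u (n + (2 * i + 1) * k) in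
  \sum_(i < m.+1) (x i * y (ordS i) - x (ordS i) * y i) =
  - ((-1) ^+ n * c *
     (m%:R * (pell k)%:R * (pell (2 * k))%:R
      - (pell k)%:R * (pell (2 * m * k))%:R)).
Proof.
(* Split off the last term, whose successor index [m.+1 %% m.+1] is 0. *)
move=> x y; rewrite big_ord_recr /= modnn.
have side (i : 'I_m) :
    x i * y (i.+1 %% m.+1)%N - x (i.+1 %% m.+1)%N * y i =
    - ((-1) ^+ n * c * (pell k)%:R * (pell (2 * k))%:R).
  rewrite modn_small ?ltnS ?ltn_ord // /x /y.
  have := pell_vajda (n + 2 * i * k) (2 * k) k.
  (* The even shift [2 * i * k] leaves the sign at [(-1) ^+ n], so this term does not depend on
     [i]. *)
  rewrite exprD -(mulnA 2) exprM sqrrN expr1n expr1n mulr1.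
  have -> : (n + 2 * (i * k) + 2 * k = n + 2 * i.+1 * k)%N by lia.
  have -> : (n + 2 * (i * k) + k = n + (2 * i + 1) * k)%N by lia.
  have -> : (n + 2 * i.+1 * k + k = n + (2 * i.+1 + 1) * k)%N by lia.
  by rewrite !mulnA => vajda; rewrite -opprB vajda; ring.
under eq_bigr do rewrite side.
rewrite sumr_const card_ord -mulr_natl /x /y.
have := pell_vajda n (2 * m * k) k.
rewrite muln0 mul0n addn0 add0n mul1n.
have -> : (n + 2 * m * k + k = n + (2 * m + 1) * k)%N by lia.
by move=> ->; ring.
Qed.

End PellRecurrence.

Lemma polygon_area_pell_recurrence (R : realFieldType) (u : nat -> R) n k m :
  pell_recurrence u -> (0 < m)%N ->
  polygon_area (fun i : 'I_m =>
      (u (n + 2 * i * k)%N, u (n + (2 * i + 1) * k)%N)) =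
  2^-1 * (`|u 1 ^+ 2 - u 0 * u 2|
    * `| (m%:R - 1) * (pell k)%:R * (pell (2 * k))%:R
         - (pell k)%:R * (pell ((2 * m - 2) * k))%:R |).
Proof.
case: m => // m uS _; rewrite /polygon_area (pell_shoelace _ _ uS) -(natr1 m) addrK.
have -> : (2 * m.+1 - 2 = 2 * m)%N by lia.
(* The sign [(-1) ^+ n] has absolute value 1, so [n] drops out of the area. *)
by rewrite normrN !normrM normrX normrN1 expr1n mul1r.
Qed.

Theorem theorem3p2 (R : realFieldType) (n k m : nat)
    (hk : (1 <= k)%N) (hm : (3 <= m)%N) :
  polygon_area (fun i : 'I_m =>
      ((pell (n + 2 * i * k))%:R : R, (pell (n + (2 * i + 1) * k))%:R : R))
    = 2^-1 * `| (m%:R - 1) * (pell k)%:R * (pell (2 * k))%:R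
                - (pell k)%:R * (pell ((2 * m - 2) * k))%:R |
  /\
  polygon_area (fun i : 'I_m =>
      ((pell_lucas (n + 2 * i * k))%:R : R,
       (pell_lucas (n + (2 * i + 1) * k))%:R : R))
    = 4 * `| (m%:R - 1) * (pell k)%:R * (pell (2 * k))%:R
             - (pell k)%:R * (pell ((2 * m - 2) * k))%:R |.
Proof.
have m_gt0 : (0 < m)%N := ltn_trans (isT : 0 < 2)%N hm.
split.
- rewrite (polygon_area_pell_recurrence _ _ _ _ _ (pell_is_pell_recurrence R)) //=.
  by rewrite mul0r subr0 expr1n normr1 mul1r.
- rewrite (polygon_area_pell_recurrence _ _ _ _ _ (pell_lucas_is_pell_recurrence R)) //.
  (* Here [pell_lucas 2] is 6, so the factor is 4 - 12; half of its absolute value is the 4 of the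
     statement. *)
  have -> : (pell_lucas 1)%:R ^+ 2 - (pell_lucas 0)%:R * (pell_lucas 2)%:R
            = - 8 :> R by rewrite /=; ring.
  by rewrite normrN normr_nat mulrA; congr (_ * _); field.
Qed.
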